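(* Let $n\ge 3$, let $(g_2,\dots,g_n)$ be a tower with cycle $C$, and let $u_n=g_{n-1}^{-1}g_n$. Then $L_{u_n}(C)=C$, and $L_{u_n}$ acts on $C$ as a rotation by $(n-1)!$ positions, of order $n$. In particular $C$ is $n$-symmetric and $\mathrm{Stab}(C)\supseteq\langle L_{u_n}\rangle\cong C_n$ (cyclic of order $n$).
   Context: Permutations in $S_n$ are multiplied as functions: $(\pi g)(i)=\pi(g(i))$. For $1\le k\le n$, $G_k=\mathrm{Sym}\{1,\dots,k\}$ is the subgroup of $S_n$ of permutations fixing each of $k+1,\dots,n$. A $k$-cycle on $\{1,\dots,k\}$ is an element of $G_k$ that is a single cycle of length $k$. A tower is a sequence $(g_2,\dots,g_n)$ with $g_k\in G_k\setminus G_{k-1}$ such that, setting $g_1:=\mathbf 1$, each $u_k:=g_{k-1}^{-1}g_k$ is a $k$-cycle on $\{1,\dots,k\}$ $(2\le k\le n)$. Words over the alphabet $\{g_2,\dots,g_n\}$: $M_1=\varepsilon$ and $M_k=(M_{k-1}\,g_k)^{k-1}M_{k-1}$ for $2\le k\le n$. Write $M_ng_n=w_1w_2\cdots w_{n!}$ and $p_m=w_1\cdots w_m\in S_n$ ($p_0=\mathbf 1$). The cycle of the tower is the Hamiltonian cycle $p_0,p_1,\dots,p_{n!-1},p_{n!}=p_0$ in $\mathrm{Cay}(S_n,\{g_2,\dots,g_n\})$ (edges are right multiplications); it is viewed as a set of undirected edges $C=\{\{p_m,p_{m+1}\}:0\le m<n!\}$, and $p_m$ is the vertex at position $m$ (indices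 modulo $n!$). For $g\in S_n$, $L_g$ is the left translation $\sigma\mapsto g\sigma$; $\mathrm{Stab}(C)$ is the setwise stabilizer of $C$ inside $L(S_n)=\{L_g:g\in S_n\}$. A Hamiltonian cycle in a graph with $N$ vertices is $k$-symmetric when rotating it by $N/k$ positions is an automorphism of the graph. *)

(* Defs.v *)
From mathcomp Require Import all_boot all_fingroup zmodp.

Set Implicit Arguments.
Unset Strict Implicit.
Unset Printing Implicit Defensive.

Local Open Scope nat_scope.

(** ** Graphs, Hamiltonian cycles and their rotations *)

Section Graphs.

Variable T : finType.
Implicit Types (e : rel T) (c : seq T) (f : T -> T).

Definition graph_aut e f := bijective f /\ {mono f : x y / e x y}.

(* [path.cycle e c] includes the closing edge from the last vertex to the first. *)
Definition hamiltonian e c := [&& path.cycle e c, uniq c & size c == #|T|].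

(* Sends the vertex at position [i] of [c] to the vertex at position
   [i + r] modulo [size c] (for [r <= size c], [c] duplicate-free and
   spanning). *)
Definition rotation c (r : nat) : T -> T :=
  fun x => nth x (rot r c) (index x c).

Definition k_symmetric e (k : nat) c :=
  [/\ hamiltonian e c, k %| #|T| & graph_aut e (rotation c (#|T| %/ k))].

End Graphs.

(** ** Permutations multiplied as functions *)

Section Perms.

Variable n : nat.
Implicit Types (s t g : 'S_n) (S : {set 'S_n}).

(* MathComp composes permutations from left to right:
   [(s * t)%g i = t (s i)]. *)
Definition fmul s t : 'S_n := (t * s)%g.

Lemma fmulE s t (i : 'I_n) : fmul s t i = s (t i).
Proof. exact: permM. Qed.

Lemma fmul_inj g : injective (fmul g).
Proof. exact: mulIg. Qed.

Definition ltrans g : {perm 'S_n} := perm (@fmul_inj g).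

Definition ltranslations : {set {perm 'S_n}} := [set ltrans g | g : 'S_n].

(* Points are numbered from 0, so this is the set written {1, ..., k}. *)
Definition points (k : nat) : {set 'I_n} := [set i : 'I_n | i < k].

Definition symk (k : nat) : {set 'S_n} := Sym (points k).

Definition is_kcycle (k : nat) s := (s \in symk k) && (points k \in porbits s).

(* Undirected Cayley graph; edges are right multiplications by [S]. *)
Definition cayley S : rel 'S_n :=
  [rel x y | [exists s in S, (y == fmul x s) || (x == fmul y s)]].

End Perms.

(** ** Towers *)

Section Towers.

Variable n : nat.
(* Only the values [g 1], ..., [g n] are meaningful. *)
Implicit Type g : nat -> 'S_n.

Definition tower_step g (k : nat) : 'S_n := fmul (g k.-1)^-1%g (g k).

Definition is_tower g :=
  g 1 = 1%g /\
  forall k, 2 <= k <= n ->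
    g k \in symk n k :\: symk n k.-1 /\ is_kcycle k (tower_step g k).

Definition tower_gens g : {set 'S_n} :=
  [set g (val k) | k : 'I_n.+1 & 2 <= k].

(* At [k = 1] the successor clause gives the empty word. *)
Fixpoint tower_word g (k : nat) : seq 'S_n :=
  if k is k'.+1 then
    flatten (nseq k' (rcons (tower_word g k') (g k))) ++ tower_word g k'
  else [::].

Definition tower_vertex g (m : nat) : 'S_n :=
  foldl (@fmul n) 1%g (take m (rcons (tower_word g n) (g n))).

Definition tower_cycle g : seq 'S_n := mkseq (tower_vertex g) n`!.

Definition tower_edges g : {set {set 'S_n}} :=
  [set [set tower_vertex g m; tower_vertex g m.+1] | m : 'I_(n`!)].

(* Setwise stabilizer, among the left translations, of a set of edges on
   which permutations of the vertices act by taking images. *)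
Definition edge_stab (C : {set {set 'S_n}}) : {set {perm 'S_n}} :=
  'N_(ltranslations n)(C | 'P^*)%g.

End Towers.

(* Main.v *)
Require Import Defs.
From mathcomp Require Import all_boot all_fingroup zmodp cyclic.

(** In functional notation, the product of the word M_k is g_k^-1: by induction
    it is (g_(k-1)^-1 g_k)^(k-1) g_(k-1)^-1 = u_k^(k-1) g_(k-1)^-1, and u_k,
    being a k-cycle, has order k, so that this is (g_(k-1) u_k)^-1 = g_k^-1
    ([word_prod_tower_word]).

    The closed word M_k g_k is the k-th power of the block M_(k-1) g_k, which
    has length (k-1)! and, by the above, product u_k.  Hence the vertex at
    position q (k-1)! + r of the closed walk of M_k g_k is u_k^q times the vertex
    at position r of the closed walk of the previous level
    ([level_vertex_decomp]).  Two consequences follow.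

    - The closed walk of level k has no repeated vertex ([level_vertex_inj]).
      The vertices of level k-1 fix the last point of {1, ..., k}, and the powers
      u_k^q with q < k move that point to k distinct places, so a vertex
      determines q, then, by induction, r.  At level n a counting argument
      makes the walk Hamiltonian.

    - At level n, left multiplication by u_n raises q by one, that is, it adds
      (n-1)! to the position ([ltrans_tower_vertex]).

    The second fact says that L_(u_n) is the rotation by (n-1)! positions, so it
    preserves the edges of the cycle; being a left translation it is an
    automorphism of the Cayley graph; and it has the order n of u_n because
    g |-> L_g is an injective morphism. *)

Set Implicit Arguments.
Unset Strict Implicit.
Unset Printing Implicit Defensive.

Local Open Scope nat_scope.

(** * Repeated words *)

Section RepeatedWords.

Variables (T : Type).
Implicit Types (B : seq T).

Lemma size_flatten_nseq B k : size (flatten (nseq k B)) = k * size B.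
Proof. by elim: k => //= k IHk; rewrite size_cat IHk mulSn. Qed.

Lemma flatten_nseqD B k l :
  flatten (nseq (k + l) B) = flatten (nseq k B) ++ flatten (nseq l B).
Proof. by rewrite nseqD flatten_cat. Qed.

Lemma take_flatten_nseq B k q r : q < k -> r <= size B ->
  take (q * size B + r) (flatten (nseq k B)) = flatten (nseq q B) ++ take r B.
Proof.
move=> ltqk ler; rewrite -(subnKC ltqk) addSnnS flatten_nseqD.
by rewrite -size_flatten_nseq takeD take_size_cat // drop_size_cat //= takel_cat.
Qed.

Lemma nth_rot x0 B r i : r <= size B -> i < size B ->
  nth x0 (rot r B) i = nth x0 B ((i + r) %% size B).
Proof.
move=> ler lti; rewrite /rot nth_cat size_drop nth_drop (addnC i).
case: ltnP => [lt_i | le_i]; first by rewrite modn_small // -ltn_subRL.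
have [j def_i] : exists j, i = size B - r + j.
  by exists (i - (size B - r)); rewrite subnKC.
rewrite def_i addKn addnA subnKC // modnDl in lti *.
have ltjr : j < r by move: lti; rewrite -{2}(subnK ler) ltn_add2l.
by rewrite nth_take // modn_small // (leq_trans ltjr).
Qed.

End RepeatedWords.

(** * Products of words and left translations *)

Section Products.

Variable n : nat.
Implicit Types (s t g : 'S_n) (w : seq 'S_n).

Definition word_prod w : 'S_n := foldl (@fmul n) 1%g w.

Lemma fmulA : associative (@fmul n).
Proof. by move=> a b c; rewrite /fmul mulgA. Qed.

Lemma word_prod_rcons w s : word_prod (rcons w s) = fmul (word_prod w) s.
Proof. by rewrite /word_prod foldl_rcons. Qed.

Lemma word_prod_cat w1 w2 :
  word_prod (w1 ++ w2) = fmul (word_prod w1) (word_prod w2).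
Proof.
elim/last_ind: w2 => [|w2 x IHw]; first by rewrite cats0 /fmul mul1g.
by rewrite -rcons_cat !word_prod_rcons IHw fmulA.
Qed.

Lemma word_prod_flatten_nseq k w :
  word_prod (flatten (nseq k w)) = (word_prod w ^+ k)%g.
Proof.
by elim: k => [|k IHk] //=; rewrite word_prod_cat IHk expgSr.
Qed.

Lemma word_prod_group (H : {group 'S_n}) w :
  {subset w <= H} -> word_prod w \in H.
Proof.
elim/last_ind: w => [|w x IHw] sub_wH; first exact: group1.
rewrite word_prod_rcons; apply: groupM; first by rewrite sub_wH // mem_rcons mem_head.
by apply: IHw => y yw; rewrite sub_wH // mem_rcons inE yw orbT.
Qed.

Lemma ltransE g s : ltrans g s = fmul g s.
Proof. exact: permE. Qed.

Lemma ltransM : {in [set: 'S_n] &, {morph @ltrans n : s t / (s * t)%g}}.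
Proof.
by move=> s t _ _; apply/permP => x; rewrite permM !ltransE /fmul mulgA.
Qed.

Canonical ltrans_morphism := Morphism ltransM.

(** Written as a morphic image, the set of left translations is visibly a
    group, hence contains all powers of its elements. *)
Lemma ltranslationsE : ltranslations n = (@ltrans n @* [set: 'S_n])%g.
Proof.
rewrite morphimEdom; apply/setP => s.
by apply/imsetP/imsetP => -[t _ ->]; exists t.
Qed.

Lemma injm_ltrans : ('injm (@ltrans n))%g.
Proof.
apply/injmP => s t _ _ /permP/(_ 1%g).
by rewrite !ltransE /fmul !mul1g.
Qed.

(** Left and right multiplications commute, so left translations preserve the
    edges of a Cayley graph built with right multiplications. *)
Lemma ltrans_graph_aut (S : {set 'S_n}) g : graph_aut (cayley S) (ltrans g).
Proof.
split=> [|x y]; first exact: (Bijective (permK _) (permKV _)).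
apply: eq_existsb => s; rewrite !ltransE -!fmulA.
by rewrite !(inj_eq (@fmul_inj n g)).
Qed.

End Products.

(** * Cycles on an initial segment *)

Section Cycles.

Variable n : nat.
Implicit Types (s u : 'S_n).

Lemma card_points k : k <= n -> #|points n k| = k.
Proof.
move=> lekn; rewrite -sum1_card.
under eq_bigl do rewrite inE.
by rewrite -(big_ord_widen _ (fun=> 1) lekn) sum1_card card_ord.
Qed.

Lemma symkP k s : reflect (forall i : 'I_n, k <= i -> s i = i) (s \in symk n k).
Proof.
rewrite inE; apply: (iffP idP) => [s_on i leki | fix_s].
  by rewrite (out_perm s_on) // inE -leqNgt.
by apply/subsetP => i; rewrite !inE ltnNge; apply: contra => /fix_s->.
Qed.

Lemma symkS j k : j <= k -> symk n j \subset symk n k.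
Proof.
move=> lejk; apply/subsetP => s /symkP fix_s; apply/symkP => i leki.
exact/fix_s/(leq_trans lejk).
Qed.

Lemma kcycle_porbit k u (i : 'I_n) :
  is_kcycle k u -> i < k -> porbit u i = points n k.
Proof.
case/andP=> _ /imsetP[x _ defx] ltik.
by rewrite defx; apply/eqP; rewrite eq_porbit_mem -defx inE.
Qed.

(** The orbit of i is all of {1, ..., k}, so the first k iterates from i exhaust it
    without repetition. *)
Lemma kcycle_expg_inj k u (i : 'I_n) a b : k <= n -> is_kcycle k u -> i < k ->
  a < k -> b < k -> (u ^+ a)%g i = (u ^+ b)%g i -> a = b.
Proof.
move=> lekn cyc_u ltik ltak ltbk; rewrite !permX.
have := uniq_traject_porbit u i.
rewrite (kcycle_porbit cyc_u ltik) card_points // => uniq_t eq_ab.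
by apply/eqP; rewrite -(nth_uniq i _ _ uniq_t) ?size_traject // !nth_traject // eq_ab.
Qed.

Lemma kcycle_order k u : 0 < k <= n -> is_kcycle k u -> #[u]%g = k.
Proof.
case/andP=> k_gt0 lekn cyc_u.
have uk1 : (u ^+ k)%g = 1%g.
  apply/permP => i; rewrite perm1; case: (ltnP i k) => [ltik | leki].
    by rewrite permX -{1}(card_points lekn) -(kcycle_porbit cyc_u ltik) iter_porbit.
  have /symkP-> // : (u ^+ k)%g \in symk n k.
  by case/andP: cyc_u => uG _; apply: groupX.
have leuk : #[u]%g <= k by rewrite dvdn_leq // order_dvdn uk1.
apply/eqP; rewrite eqn_leq leuk leqNgt; apply/negP => ltuk.
have n_gt0 : 0 < n by apply: leq_trans lekn.
suff eq0 : #[u]%g = 0 by have := order_gt0 u; rewrite eq0.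
apply: (@kcycle_expg_inj k u (Ordinal n_gt0)) => //.
by rewrite expg_order.
Qed.

End Cycles.

(** * The closed walks of a tower *)

Section Towers.

Variable n : nat.
Variable g : nat -> 'S_n.
Hypothesis g_tower : is_tower g.

Lemma tower_wordS k : tower_word g k.+1 =
  flatten (nseq k (rcons (tower_word g k) (g k.+1))) ++ tower_word g k.
Proof. by []. Qed.

Lemma size_tower_word k : (size (tower_word g k)).+1 = k`!.
Proof.
elim: k => //= k IHk; rewrite size_cat size_flatten_nseq size_rcons IHk.
by rewrite -addnS IHk factS mulSn addnC.
Qed.

(** The trailing copy of M_k together with the closing letter is one more block,
    which makes M_(k+1) g_(k+1) an exact power of M_k g_(k+1). *)
Lemma rcons_tower_word k :
  rcons (tower_word g k.+1) (g k.+1) =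
  flatten (nseq k.+1 (rcons (tower_word g k) (g k.+1))).
Proof.
have := flatten_nseqD (rcons (tower_word g k) (g k.+1)) k 1.
by rewrite addn1 => -> /=; rewrite cats0 rcons_cat.
Qed.

Lemma tower_letter k x : x \in tower_word g k ->
  exists2 j, 2 <= j <= k & x = g j.
Proof.
elim: k => // k IHk /=.
have word_k : x \in tower_word g k -> exists2 j, 2 <= j <= k.+1 & x = g j.
  case/IHk=> j /andP[le2j lejk] ->; exists j => //.
  by rewrite le2j leqW.
rewrite mem_cat => /orP[|//] /flattenP[w].
case: k {IHk} word_k => // k word_k.
rewrite mem_nseq /= => /eqP->; rewrite mem_rcons inE => /predU1P[-> | //].
by exists k.+2; rewrite ?leqnn.
Qed.

Lemma tower_gen_symk k : 0 < k <= n -> g k \in symk n k.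
Proof.
case: k => [|[_|k le_k]] //; first by rewrite g_tower.1 group1.
by have [] := g_tower.2 k.+2 le_k; rewrite in_setD => /andP[].
Qed.

Lemma tower_step_kcycle k : 0 < k < n -> is_kcycle k.+1 (tower_step g k.+1).
Proof. by move=> le_k; have [] := g_tower.2 k.+1 le_k. Qed.

Lemma tower_step_order k : 0 < k < n -> #[tower_step g k.+1]%g = k.+1.
Proof.
move=> lt_k; apply: (kcycle_order (n := n)); last exact: tower_step_kcycle.
by case/andP: lt_k.
Qed.

(** This identity is what makes the blocks multiply to u_(k+1), and the walk at
    level n close up. *)
Lemma word_prod_tower_word k : 0 < k <= n ->
  word_prod (tower_word g k) = (g k)^-1%g.
Proof.
elim: k => // -[_ _|k IHk ltkn]; first by rewrite /= g_tower.1 invg1.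
have step1 : (tower_step g k.+2 ^+ k.+2 = 1)%g.
  by apply/eqP; rewrite -order_dvdn (@tower_step_order k.+1).
rewrite tower_wordS word_prod_cat word_prod_flatten_nseq.
rewrite word_prod_rcons IHk ?(ltnW ltkn) // -/(tower_step g k.+2).
have -> : (tower_step g k.+2 ^+ k.+1 = (tower_step g k.+2)^-1)%g.
  by apply: (mulIg (tower_step g k.+2)); rewrite mulVg -expgSr.
by rewrite /tower_step /fmul /= invMg invgK mulgA mulVg mul1g.
Qed.

(** Stopping the construction at level k is what allows induction on the level;
    [tower_vertex g] is the case k = n. *)
Definition level_vertex k m :=
  word_prod (take m (rcons (tower_word g k) (g k))).

(** The first q blocks contribute u_(k+1)^q, since each has product
    g_k^-1 g_(k+1); what remains is a proper prefix of a block, hence a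
    prefix of M_k. *)
Lemma level_vertex_decomp k q r : 0 < k < n -> q <= k -> r < k`! ->
  level_vertex k.+1 (q * k`! + r) =
  fmul (tower_step g k.+1 ^+ q)%g (level_vertex k r).
Proof.
case/andP=> k_gt0 ltkn leqk ltr; rewrite /level_vertex rcons_tower_word.
have size_block : size (rcons (tower_word g k) (g k.+1)) = k`!.
  by rewrite size_rcons size_tower_word.
rewrite -[in LHS]size_block take_flatten_nseq ?size_block ?(ltnW ltr) //.
rewrite word_prod_cat word_prod_flatten_nseq.
congr (fmul (_ ^+ _)%g (word_prod _)).
  by rewrite word_prod_rcons word_prod_tower_word // k_gt0 ltnW.
(* The two closed words differ only in their last letter, at position k!. *)
by rewrite -!cats1 !takel_cat // -ltnS size_tower_word.
Qed.

Lemma level_vertex_symk k m : 0 < k <= n -> level_vertex k m \in symk n k.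
Proof.
case/andP=> k_gt0 lekn; apply: word_prod_group => x /mem_take.
rewrite mem_rcons inE => /predU1P[->|]; first by rewrite tower_gen_symk ?k_gt0.
case/tower_letter=> j /andP[le2j lejk] ->.
apply: (subsetP (symkS n lejk)); apply: tower_gen_symk.
by rewrite ltnW //= (leq_trans lejk).
Qed.

(** The image of the last point of level k+1 reveals the quotient of the
    position by k!, since the vertices of level k fix that point. *)
Lemma level_vertex_inj k a b : 0 < k <= n -> a < k`! -> b < k`! ->
  level_vertex k a = level_vertex k b -> a = b.
Proof.
elim: k a b => // -[_ [|a] [|b] //|k IHk] a b ltkn lta ltb.
have lt_k : 0 < k.+1 < n by [].
have fact_k := fact_gt0 k.+1.
rewrite (divn_eq a k.+1`!) (divn_eq b k.+1`!).
set qa := a %/ _; set qb := b %/ _.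
have ltqa : qa < k.+2 by rewrite ltn_divLR.
have ltqb : qb < k.+2 by rewrite ltn_divLR.
have lera : a %% k.+1`! < k.+1`! by rewrite ltn_mod.
have lerb : b %% k.+1`! < k.+1`! by rewrite ltn_mod.
rewrite !level_vertex_decomp // => eq_ab.
pose last_pt : 'I_n := Ordinal ltkn.
have fix_last m : level_vertex k.+1 m last_pt = last_pt.
  have /symkP fix_m : level_vertex k.+1 m \in symk n k.+1.
    exact/level_vertex_symk/ltnW.
  exact/fix_m/leqnn.
have eq_q : qa = qb.
  apply: (kcycle_expg_inj (i := last_pt) ltkn (tower_step_kcycle lt_k)) => //.
  by have /permP/(_ last_pt) := eq_ab; rewrite !fmulE !fix_last.
rewrite eq_q in eq_ab *; congr (_ + _).
by apply: IHk => //; [exact: ltnW | exact: fmul_inj eq_ab].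
Qed.

End Towers.

(** * The Hamiltonian cycle and its rotation *)

Section TowerCycle.

Variable n : nat.
Variable g : nat -> 'S_n.
Hypotheses (n_gt1 : 1 < n) (g_tower : is_tower g).

Local Notation L := (ltrans (tower_step g n)).
Local Notation p := (tower_vertex g).

Let fact_n : n * n.-1`! = n`!.
Proof. by rewrite -[in LHS](prednK (ltnW n_gt1)) -factS prednK // ltnW. Qed.

Lemma tower_vertex0 : p 0 = 1%g.
Proof. by rewrite /tower_vertex take0. Qed.

Lemma tower_vertex_last : p n`! = 1%g.
Proof.
rewrite /tower_vertex take_oversize ?size_rcons ?size_tower_word //.
rewrite -/(word_prod _) word_prod_rcons word_prod_tower_word //.
  by rewrite /fmul mulgV.
by rewrite leqnn ltnW.
Qed.

Lemma tower_vertex_mod m : m <= n`! -> p (m %% n`!) = p m.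
Proof.
rewrite leq_eqVlt => /predU1P[-> | ltm]; last by rewrite modn_small.
by rewrite modnn tower_vertex0 tower_vertex_last.
Qed.

Lemma tower_vertex_inj a b : a < n`! -> b < n`! -> p a = p b -> a = b.
Proof. by apply: level_vertex_inj; rewrite // leqnn ltnW. Qed.

(** Raising the exponent of the step in [level_vertex_decomp] by one shifts the
    position by (n-1)!; the last block wraps around because the step has
    order n. *)
Lemma ltrans_tower_vertex m : m < n`! -> L (p m) = p ((m + n.-1`!) %% n`!).
Proof.
case: n n_gt1 g g_tower fact_n m => // k k_gt0 g' tower' /= fact_k m ltm.
have lt_k : 0 < k < k.+1 by rewrite ltnSn andbT.
have decomp q r : q <= k -> r < k`! -> tower_vertex g' (q * k`! + r) =
    fmul (tower_step g' k.+1 ^+ q)%g (level_vertex g' k r).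
  exact: level_vertex_decomp.
rewrite ltransE (divn_eq m k`!).
set q := m %/ _; set r := m %% _.
have ltr : r < k`! by rewrite ltn_mod fact_gt0.
have leq : q <= k by rewrite -ltnS ltn_divLR ?fact_gt0 // fact_k.
have -> : fmul (tower_step g' k.+1) (tower_vertex g' (q * k`! + r)) =
    fmul (tower_step g' k.+1 ^+ q.+1)%g (level_vertex g' k r).
  by rewrite decomp // fmulA expgSr.
rewrite addnAC -mulSnr.
move: leq; rewrite leq_eqVlt => /predU1P[eqk | ltqk].
- have -> : (tower_step g' k.+1 ^+ q.+1 = tower_step g' k.+1 ^+ 0)%g.
    by apply/eqP; rewrite eqk -order_dvdn tower_step_order.
  rewrite -decomp // eqk fact_k modnDl modn_small //.
  by apply: leq_trans ltr _; rewrite -fact_k leq_pmull.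
- rewrite modn_small ?decomp // -fact_k.
  apply: (@leq_trans (q.+2 * k`!)); last by rewrite leq_mul2r ltnS ltqk orbT.
  by rewrite -addnS [leqRHS]mulSnr leq_add2l.
Qed.

(** Inclusion suffices: a left translation is injective on sets of vertices, so the
    image has as many edges as the cycle. *)
Lemma tower_edges_stable : [set L @: E | E : {set 'S_n} in tower_edges g] = tower_edges g.
Proof.
have N_gt0 := fact_gt0 n.
apply/eqP; rewrite eqEcard; apply/andP; split; last first.
  by rewrite (card_imset _ (imset_inj (@perm_inj _ L))).
apply/subsetP => _ /imsetP[_ /imsetP[m _ ->] ->].
pose m' : 'I_(n`!) := Ordinal (ltn_pmod (m + n.-1`!) N_gt0).
apply/imsetP; exists m' => //.
rewrite imsetU1 imset_set1 ltrans_tower_vertex //; congr [set _; _].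
rewrite -(tower_vertex_mod (ltn_ord m)) ltrans_tower_vertex ?ltn_mod //.
rewrite -(tower_vertex_mod (ltn_ord m')) /= modnDml.
by rewrite -[in RHS]addn1 modnDml addn1 addSn.
Qed.

Lemma size_tower_cycle : size (tower_cycle g) = #|'S_n|.
Proof. by rewrite size_mkseq card_Sn. Qed.

Lemma tower_cycle_uniq : uniq (tower_cycle g).
Proof.
rewrite map_inj_in_uniq ?iota_uniq // => a b.
by rewrite !mem_iota; apply: tower_vertex_inj.
Qed.

Lemma mem_tower_cycle x : x \in tower_cycle g.
Proof.
have [||_ ->] := uniq_min_size (s2 := enum 'S_n) tower_cycle_uniq.
- by move=> y _; rewrite mem_enum.
- by rewrite size_tower_cycle cardE.
by rewrite mem_enum.
Qed.

Lemma tower_vertexP x : exists2 m, m < n`! & x = p m.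
Proof.
have /mapP[m] := mem_tower_cycle x; rewrite mem_iota => ltm ->.
by exists m.
Qed.

Lemma tower_vertex_edge m : m < n`! -> cayley (tower_gens g) (p m) (p m.+1).
Proof.
move=> ltm; rewrite /tower_vertex -!/(word_prod _).
set w := rcons _ _; have ltmw : m < size w by rewrite size_rcons size_tower_word.
rewrite (take_nth 1%g ltmw) word_prod_rcons /=.
apply/existsP; exists (nth 1%g w m); rewrite eqxx andbT.
have: nth 1%g w m \in w by rewrite mem_nth.
rewrite mem_rcons inE => /predU1P[-> | /tower_letter[j /andP[le2j lejn] ->]].
  by apply/imsetP; exists ord_max; rewrite ?inE.
have ltj : j < n.+1 by [].
by apply/imsetP; exists (Ordinal ltj); rewrite ?inE.
Qed.

Lemma tower_cycle_hamiltonian :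
  hamiltonian (cayley (tower_gens g)) (tower_cycle g).
Proof.
rewrite /hamiltonian tower_cycle_uniq size_tower_cycle eqxx !andbT.
have [N defN] : exists N, n`! = N.+1 by case: n`! (fact_gt0 n) => // N; exists N.
(* The walk returns to its origin, so the closing edge is its last step. *)
have closed : rcons (map p (iota 1 N)) (p 0) = map p (iota 1 N.+1).
  rewrite tower_vertex0 -tower_vertex_last defN -map_rcons.
  by rewrite -[N.+1 in RHS]addn1 iotaD cats1 add1n.
have -> : tower_cycle g = p 0 :: map p (iota 1 N) by rewrite /tower_cycle defN.
rewrite /path.cycle closed.
apply/(pathP 1%g) => i; rewrite size_map size_iota => ltiN.
rewrite -[_ :: _]/(map p (iota 0 N.+2)) !(nth_map 0) ?size_iota ?ltnS ?(ltnW ltiN) //.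
rewrite !nth_iota ?ltnS ?(ltnW ltiN) //.
by apply: tower_vertex_edge; rewrite defN.
Qed.

Lemma rotation_tower_cycle x : rotation (tower_cycle g) n.-1`! x = L x.
Proof.
have [m ltm ->] := tower_vertexP x; rewrite ltrans_tower_vertex //.
have size_c : size (tower_cycle g) = n`! by rewrite size_mkseq.
have index_p : index (p m) (tower_cycle g) = m.
  by rewrite -{1}(nth_mkseq 1%g p ltm) index_uniq ?size_c // tower_cycle_uniq.
rewrite /rotation index_p nth_rot size_c ?nth_mkseq ?ltn_mod ?fact_gt0 //.
by rewrite -fact_n leq_pmull // ltnW.
Qed.

End TowerCycle.

Theorem lemma5p3 (n : nat) (g : nat -> 'S_n) :
  3 <= n -> is_tower g ->
  let L := ltrans (tower_step g n) in
  let C := tower_edges g in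
  [set L @: E | E : {set 'S_n} in C] = C /\
  (forall m, m < n`! ->
     L (tower_vertex g m) = tower_vertex g ((m + (n.-1)`!) %% n`!)) /\
  #[L]%g = n /\
  k_symmetric (cayley (tower_gens g)) n (tower_cycle g) /\
  <[L]>%g \subset edge_stab C /\
  (<[L]> \isog Zp n)%g.
Proof.
move=> n_gt2 g_tower L C; have n_gt1 := ltnW n_gt2.
have stableC : [set L @: E | E : {set 'S_n} in C] = C.
  exact: tower_edges_stable.
have orderL : #[L]%g = n.
  rewrite order_injm ?injm_ltrans ?inE //.
  have := @tower_step_order n g g_tower n.-1; rewrite (prednK (ltnW n_gt1)).
  by apply; rewrite leqnn ltn_predRL n_gt1.
split=> //; split; first by move=> m; apply: ltrans_tower_vertex.
split=> //; split; last split.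
- split; first exact: tower_cycle_hamiltonian.
    by rewrite card_Sn dvdn_fact // leqnn ltnW.
  rewrite card_Sn; have -> : n`! %/ n = n.-1`!.
    by case: (n) n_gt1 => // k _; rewrite factS mulKn.
  have [bijL monoL] := ltrans_graph_aut (tower_gens g) (tower_step g n).
  have rotE := rotation_tower_cycle n_gt1 g_tower.
  split; first exact: (eq_bij bijL (fsym rotE)).
  by move=> x y; rewrite !rotE.
- rewrite /edge_stab subsetI ltranslationsE !cycle_subG; apply/andP; split.
    by rewrite mem_morphim ?inE.
  rewrite !inE /=; apply/subsetP => E E_C; rewrite inE -stableC.
  exact: (imset_f (fun A : {set 'S_n} => L @: A) E_C).
- by rewrite isog_sym; have := Zp_isog L; rewrite orderL.
Qed.
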